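(* For integers $s\ge1$ and real $x$ define \[p_s(x)=\sum_{k=1}^{s-1}\frac{(-1)^{k-1}\pi^{2k}}{(2k+1)!}x^{2k},\qquad q_s(x)=\sum_{k=0}^{s-1}\frac{(-1)^k\pi^{2k}}{(2k+1)!}x^{2k},\] \[z_s(x)=\frac{(-1)^{s-1}s\pi^{2s}}{(2s+1)!}+p_s(x),\qquad t_s(x)=\frac{(-1)^{s-1}\pi^{2s}}{4(2s)!}+p_s(x).\] Let $k\in\{2s,2s-1\}$. Then: for $s\ge17$, $\zeta(k)-3\{\zeta(k)\}^2\le z_s(\zeta(k))\le\zeta(k)$; for $s\ge38$, $\theta(k)-3\{\theta(k)\}^2\le t_s(\theta(k))\le\theta(k)$; for $s\ge34$, $\frac{1}{\zeta(k)}-\{\zeta(k)\}^3\le 1+q_s(\zeta(k))\le\frac{1}{\zeta(k)}+11\{\zeta(k)\}^3$; for $s\ge114$, $\frac{1}{\theta(k)}-\{\theta(k)\}^3\le 1+q_s(\theta(k))\le\frac{1}{\theta(k)}+11\{\theta(k)\}^3$.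
   Context: $\zeta(k)=\sum_{n\ge1}n^{-k}$, $\theta(k)=\sum_{n\ge0}(2n+1)^{-k}=(1-2^{-k})\zeta(k)$. $\{y\}$ denotes the fractional part of $y$; here $\{\zeta(k)\}=\zeta(k)-1$ and $\{\theta(k)\}=\theta(k)-1$. *)

(* Defs.v *)
From Stdlib Require Import Reals Factorial.
From Coquelicot Require Import Coquelicot.
Open Scope R_scope.

(* [Series] is the sum when the series converges, that is, for k >= 2. *)
Definition zeta (k : nat) : R := Series (fun n : nat => / INR (n + 1) ^ k).

Definition theta (k : nat) : R := Series (fun n : nat => / INR (2 * n + 1) ^ k).

(* [sum_n_m a 1 0] is the empty sum, so [p_poly 1 x = 0]; for s = 0 the
   truncated [s - 1] makes these definitions meaningless. *)
Definition p_poly (s : nat) (x : R) : R :=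
  sum_n_m (fun k : nat =>
    (-1) ^ (k - 1) * PI ^ (2 * k) / INR (fact (2 * k + 1)) * x ^ (2 * k))
    1 (s - 1).

Definition q_poly (s : nat) (x : R) : R :=
  sum_n_m (fun k : nat =>
    (-1) ^ k * PI ^ (2 * k) / INR (fact (2 * k + 1)) * x ^ (2 * k))
    0 (s - 1).

Definition z_poly (s : nat) (x : R) : R :=
  (-1) ^ (s - 1) * INR s * PI ^ (2 * s) / INR (fact (2 * s + 1)) + p_poly s x.

Definition t_poly (s : nat) (x : R) : R :=
  (-1) ^ (s - 1) * PI ^ (2 * s) / (4 * INR (fact (2 * s))) + p_poly s x.

(* Main.v *)
(** Put [x = 1 + d] with [d] the fractional part, so that
    [sin (PI x) / (PI x) = - sin (PI d) / (PI x)].  The polynomial [q_s] is a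
    Taylor section of [sin (PI x) / (PI x)], hence
    [q_s x = - (d - O(d^3)) / (1 + d)] up to the first omitted Taylor term, which
    is of size [(PI x)^(2s) / (2s+1)!].  Since [d >= 2^-k] for [zeta] and
    [d >= 3^-k] for [theta], with [k <= 2s], the powers of [d] in the claim
    decay only geometrically in [s], so the factorial wins from the stated
    thresholds on. *)
Require Import Defs.
From Stdlib Require Import Reals Lra Lia ZArith Factorial.
From Coquelicot Require Import Coquelicot.
Open Scope R_scope.

(** Binary, so that values up to [228!] can be evaluated. *)
Fixpoint Zfact (n : nat) : Z :=
  match n with
  | O => 1%Z
  | S m => (Z.of_nat n * Zfact m)%Z
  end.

Lemma INR_fact_Zfact (n : nat) : INR (fact n) = IZR (Zfact n).
Proof.
  induction n as [| n IH]; [reflexivity |].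
  rewrite fact_simpl, mult_INR, IH, INR_IZR_INZ, <- mult_IZR; reflexivity.
Qed.

(** * Numerical bounds for pi and the sine *)

(** Otherwise [1575 / 1000] would be at most [PI / 2] and have nonnegative cosine, but the Taylor
    upper bound of degree 8 is already negative there. *)
Lemma PI_lt_315 : PI < 315 / 100.
Proof.
  destruct (Rlt_or_le PI (315 / 100)) as [h | h]; [exact h | exfalso].
  assert (hc : 0 <= cos (1575 / 1000)) by (apply cos_ge_0; lra).
  destruct (pre_cos_bound (1575 / 1000) 1) as [_ hu]; [lra | lra |].
  unfold cos_approx, cos_term in hu.
  cbn -[fact INR] in hu; rewrite !INR_fact_Zfact in hu; simpl in hu; lra.
Qed.

(** Consecutive Taylor sums enclose the sine on [[0, 4]], so the error is at most the first omitted
    term. *)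
Lemma sin_approx_error (a : R) (m : nat) :
  0 <= a <= 4 -> (1 <= m)%nat ->
  Rabs (sin a - sin_approx a m) <= a ^ (2 * m + 3) / INR (fact (2 * m + 3)).
Proof.
  intros [h0 h4] hm.
  assert (hstep : sin_approx a (S m) = sin_approx a m + sin_term a (S m))
    by reflexivity.
  assert (hterm : sin_term a (S m)
                  = (-1) ^ S m * (a ^ (2 * m + 3) / INR (fact (2 * m + 3)))).
  { unfold sin_term; replace (2 * S m + 1)%nat with (2 * m + 3)%nat by lia.
    reflexivity. }
  assert (hpos : 0 <= a ^ (2 * m + 3) / INR (fact (2 * m + 3))).
  { apply Rdiv_le_0_compat; [now apply pow_le | apply INR_fact_lt_0]. }
  set (t := a ^ (2 * m + 3) / INR (fact (2 * m + 3))) in *.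
  (* The sum up to index [m] lies above the sine for even [m] and below it for odd [m]. *)
  destruct (Nat.Even_or_Odd m) as [[j hj] | [j hj]].
  - destruct j as [| j]; [lia |].
    destruct (pre_sin_bound a j h0 h4) as [_ hu].
    destruct (pre_sin_bound a (S j) h0 h4) as [hl _].
    replace (2 * (j + 1))%nat with m in hu by lia.
    replace (2 * S j + 1)%nat with (S m) in hl by lia.
    replace ((-1) ^ S m) with (-1) in hterm
      by (replace (S m) with (S (2 * S j)) by lia; now rewrite pow_1_odd).
    apply Rabs_le; lra.
  - destruct (pre_sin_bound a j h0 h4) as [hl hu].
    replace (2 * j + 1)%nat with m in hl by lia.
    replace (2 * (j + 1))%nat with (S m) in hu by lia.
    replace ((-1) ^ S m) with 1 in hterm
      by (replace (S m) with (2 * S j)%nat by lia; now rewrite pow_1_even).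
    apply Rabs_le; lra.
Qed.

(** This is [y - y ^ 3 / 6 <= sin y <= y] at [y = PI * d]; the constant 2 comes from
    [PI ^ 2 <= 12]. *)
Lemma sin_PI_mul_div_PI_bounds (d : R) :
  0 <= d <= 1 -> d - 2 * d ^ 3 <= sin (PI * d) / PI <= d.
Proof.
  intros hd.
  assert (hP := PI_RGT_0). assert (hP' := PI_lt_315).
  assert (hu : 0 <= PI * d) by nra.
  assert (hu4 : PI * d <= 4) by nra.
  assert (hP2 : PI ^ 2 <= 12) by nra.
  assert (hd3 : 0 <= d ^ 3) by (apply pow_le; lra).
  split.
  - destruct (pre_sin_bound (PI * d) 0 hu hu4) as [hl _].
    unfold sin_approx, sin_term in hl.
    cbn -[fact INR] in hl; rewrite !INR_fact_Zfact in hl; simpl in hl.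
    apply Rmult_le_reg_r with PI; [exact hP |].
    replace (sin (PI * d) / PI * PI) with (sin (PI * d)) by (field; lra).
    assert (h : PI * (PI ^ 2 * d ^ 3) <= PI * (12 * d ^ 3))
      by (apply Rmult_le_compat_l; [| apply Rmult_le_compat_r]; lra).
    lra.
  - apply Rmult_le_reg_r with PI; [exact hP |].
    replace (sin (PI * d) / PI * PI) with (sin (PI * d)) by (field; lra).
    destruct (Req_dec d 0) as [-> | hd0].
    + rewrite Rmult_0_r, sin_0; lra.
    + left; rewrite (Rmult_comm d); apply sin_lt_x; nra.
Qed.

(** * The polynomials as Taylor sections of the sine *)

Lemma q_poly_sin_approx (s : nat) (x : R) :
  (1 <= s)%nat -> PI * x * q_poly s x = sin_approx (PI * x) (s - 1).
Proof.
  intros hs; unfold q_poly, sin_approx.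
  rewrite <- sum_n_Reals; unfold sum_n.
  assert (hm := @sum_n_m_mult_l R_Ring (PI * x)
    (fun k : nat =>
       (-1) ^ k * PI ^ (2 * k) / INR (fact (2 * k + 1)) * x ^ (2 * k))
    0 (s - 1)).
  simpl in hm; etransitivity; [symmetry; exact hm |].
  apply sum_n_m_ext; intros k; unfold sin_term.
  change (PI * x * ((-1) ^ k * PI ^ (2 * k) / INR (fact (2 * k + 1)) * x ^ (2 * k))
    = (-1) ^ k * ((PI * x) ^ (2 * k + 1) / INR (fact (2 * k + 1)))).
  rewrite Rpow_mult_distr, !pow_add, !pow_1.
  field; apply INR_fact_neq_0.
Qed.

(** The term of [q_poly] at [k = 0] is 1, and every later term is the negative of the one in
    [p_poly]. *)
Lemma p_poly_q_poly (s : nat) (x : R) :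
  (1 <= s)%nat -> p_poly s x = 1 - q_poly s x.
Proof.
  intros hs; unfold p_poly, q_poly.
  rewrite (sum_Sn_m _ 0 (s - 1)) by lia.
  set (b := fun k : nat =>
    (-1) ^ k * PI ^ (2 * k) / INR (fact (2 * k + 1)) * x ^ (2 * k)).
  rewrite (sum_n_m_ext_loc _ (fun k => mult (-1) (b k)) 1 (s - 1)).
  - rewrite sum_n_m_mult_l.
    change (-1 * sum_n_m b 1 (s - 1) = 1 - (b 0%nat + sum_n_m b 1 (s - 1))).
    replace (b 0%nat) with 1 by (unfold b; simpl; field); ring.
  - intros k hk; unfold b.
    destruct k as [| k]; [lia |].
    replace (S k - 1)%nat with k by lia.
    change (((-1) ^ k * PI ^ (2 * S k) / INR (fact (2 * S k + 1)) * x ^ (2 * S k))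
      = -1 * ((-1) ^ S k * PI ^ (2 * S k) / INR (fact (2 * S k + 1))
              * x ^ (2 * S k))).
    rewrite <- (tech_pow_Rmult (-1) k); unfold Rdiv; ring.
Qed.

(** [101 / 10] bounds [(PI x)^2]. *)
Lemma q_poly_one_plus_error (s : nat) (d : R) :
  (2 <= s)%nat -> 0 <= d <= / 256 ->
  Rabs (q_poly s (1 + d) + sin (PI * d) / PI / (1 + d))
    <= (101 / 10) ^ s / INR (fact (2 * s + 1)).
Proof.
  intros hs hd.
  assert (hP := PI_RGT_0). assert (hP' := PI_lt_315).
  assert (ha : 0 < PI * (1 + d)) by nra.
  (* [3.15 * (1 + 1/256) < 3.17], and [3.17 ^ 2 < 10.1]. *)
  assert (ha' : PI * (1 + d) <= 317 / 100) by nra.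
  assert (he := sin_approx_error (PI * (1 + d)) (s - 1)).
  rewrite <- q_poly_sin_approx in he by lia.
  replace (2 * (s - 1) + 3)%nat with (S (2 * s)) in he by lia.
  replace (2 * s + 1)%nat with (S (2 * s)) by lia.
  assert (hsin : sin (PI * (1 + d)) = - sin (PI * d)).
  { replace (PI * (1 + d)) with (PI * d + PI) by ring; apply neg_sin. }
  specialize (he ltac:(lra) ltac:(lia)).
  rewrite hsin in he.
  replace (q_poly s (1 + d) + sin (PI * d) / PI / (1 + d)) with
    (- ((- sin (PI * d) - PI * (1 + d) * q_poly s (1 + d)) / (PI * (1 + d))))
    by (field; lra).
  rewrite Rabs_Ropp; unfold Rdiv at 1.
  rewrite Rabs_mult, Rabs_inv, (Rabs_pos_eq (PI * (1 + d))) by lra.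
  apply Rmult_le_reg_r with (PI * (1 + d)); [exact ha |].
  rewrite Rmult_assoc, Rinv_l, Rmult_1_r by lra.
  apply Rle_trans with (1 := he).
  assert (hf := INR_fact_lt_0 (S (2 * s))).
  unfold Rdiv; rewrite Rmult_assoc, (Rmult_comm (/ _)), <- Rmult_assoc.
  apply Rmult_le_compat_r; [left; now apply Rinv_0_lt_compat |].
  (* With [a = PI * (1 + d)], one factor of [a ^ (2 * s + 1)] cancels the division by [a], leaving
     [(a ^ 2) ^ s]. *)
  rewrite <- tech_pow_Rmult, Rmult_comm.
  apply Rmult_le_compat_r; [lra |].
  rewrite pow_mult; apply pow_incr; split; [apply pow2_ge_0 | nra].
Qed.

(** * Factorials against geometric growth *)

(** Going from [m] to [m + 1] multiplies the left side by [c] and the right side by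
    [(2m + 1)(2m + 2)], which is at least [c] once [m >= s0]. A single integer comparison at [s0]
    therefore suffices. *)
Lemma pow_le_fact_double (p q c : Z) (s0 s : nat) :
  (s0 <= s)%nat -> (0 < p)%Z -> (0 < q)%Z ->
  (0 < c <= Z.of_nat (2 * s0 + 1) * Z.of_nat (2 * s0 + 1))%Z ->
  (p * c ^ Z.of_nat s0 <= q * Zfact (2 * s0))%Z ->
  IZR p * IZR c ^ s <= IZR q * INR (fact (2 * s)).
Proof.
  intros hs hp hq hc h0.
  rewrite INR_fact_Zfact, pow_IZR, <- !mult_IZR; apply IZR_le.
  induction hs as [| m hm IH]; [exact h0 |].
  replace (2 * S m)%nat with (S (S (2 * m))) by lia; cbn [Zfact].
  rewrite Nat2Z.inj_succ, Z.pow_succ_r by lia.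
  set (F := Zfact (2 * m)) in *; set (P := (c ^ Z.of_nat m)%Z) in *.
  assert (hP : (0 < P)%Z) by (apply Z.pow_pos_nonneg; lia).
  assert (hF : (0 < q * F)%Z) by nia.
  assert (hcc : (c <= Z.of_nat (S (S (2 * m))) * Z.of_nat (S (2 * m)))%Z) by nia.
  apply Z.le_trans with (c * (q * F))%Z; [nia |].
  apply Z.le_trans with
    ((Z.of_nat (S (S (2 * m))) * Z.of_nat (S (2 * m))) * (q * F))%Z; nia.
Qed.

(** Since [d ^ j >= (b ^ (2 * j)) ^ - s], it is enough that [c] dominates
    [101 / 10 * b ^ (2 * j)]. *)
Lemma pow_div_fact_le (p q c b : Z) (j k s0 s : nat) (d : R) :
  (s0 <= s)%nat -> (0 < p)%Z -> (0 < q)%Z -> (1 <= b)%Z -> (k <= 2 * s)%nat ->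
  / IZR b ^ k <= d ->
  (0 < c <= Z.of_nat (2 * s0 + 1) * Z.of_nat (2 * s0 + 1))%Z ->
  (101 * b ^ (2 * Z.of_nat j) <= 10 * c)%Z ->
  (p * c ^ Z.of_nat s0 <= q * Zfact (2 * s0))%Z ->
  IZR p * ((101 / 10) ^ s / INR (fact (2 * s))) <= IZR q * d ^ j.
Proof.
  intros hs hp hq hb hk hd hc hbc h0.
  assert (hF := INR_fact_lt_0 (2 * s)).
  assert (hf := pow_le_fact_double p q c s0 s hs hp hq hc h0).
  assert (hb1 : 1 <= IZR b) by (apply IZR_le; lia).
  assert (hp' : 0 < IZR p) by (apply IZR_lt; lia).
  assert (hq' : 0 < IZR q) by (apply IZR_lt; lia).
  assert (hbk : 0 < IZR b ^ (2 * s)) by (apply pow_lt; lra).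
  assert (hd' : / IZR b ^ (2 * s) <= d).
  { apply Rle_trans with (2 := hd).
    apply Rinv_le_contravar; [apply pow_lt; lra | now apply Rle_pow]. }
  assert (hi : 0 < / IZR b ^ (2 * s)) by now apply Rinv_0_lt_compat.
  assert (hdj : / (IZR b ^ (2 * j)) ^ s <= d ^ j).
  { apply Rle_trans with ((/ IZR b ^ (2 * s)) ^ j).
    - rewrite pow_inv, <- !pow_mult; right; do 2 f_equal; lia.
    - apply pow_incr; lra. }
  assert (hB : 101 / 10 * IZR b ^ (2 * j) <= IZR c).
  { apply IZR_le in hbc; rewrite !mult_IZR in hbc.
    replace (2 * Z.of_nat j)%Z with (Z.of_nat (2 * j)) in hbc by lia.
    rewrite <- pow_IZR in hbc; lra. }
  assert (hg : 0 < IZR b ^ (2 * j)) by (apply pow_lt; lra).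
  set (g := IZR b ^ (2 * j)) in *.
  assert (hgs : 0 < g ^ s) by now apply pow_lt.
  apply Rle_trans with (IZR q * / g ^ s);
    [| apply Rmult_le_compat_l; [lra | exact hdj]].
  apply Rmult_le_reg_r with (g ^ s * INR (fact (2 * s))); [nra |].
  replace (IZR p * ((101 / 10) ^ s / INR (fact (2 * s))) *
    (g ^ s * INR (fact (2 * s)))) with (IZR p * (101 / 10 * g) ^ s)
    by (rewrite Rpow_mult_distr; field; lra).
  replace (IZR q * / g ^ s * (g ^ s * INR (fact (2 * s))))
    with (IZR q * INR (fact (2 * s))) by (field; lra).
  apply Rle_trans with (2 := hf); apply Rmult_le_compat_l; [lra |].
  apply pow_incr; nra.
Qed.

(** * Size of the fractional parts of zeta and theta *)

Lemma frac_part_one_plus (d : R) : 0 <= d < 1 -> frac_part (1 + d) = d.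
Proof.
  intros hd; unfold frac_part.
  rewrite <- (Int_part_spec (1 + d) 1); lra.
Qed.

(** The dominating series telescopes to [c], which gives convergence and the upper bound; the lower
    bound keeps the first two terms. *)
Lemma Series_telescope_bounds (a : nat -> R) (c : R) :
  a O = 1 ->
  (forall n, 0 <= a (S n) <= c * (/ INR (n + 1) - / INR (n + 2))) ->
  1 + a 1%nat <= Series a <= 1 + c.
Proof.
  intros ha0 ha.
  assert (hb : is_series (fun n => c * (/ INR (n + 1) - / INR (n + 2))) c).
  { change (is_lim_seq
      (sum_n (fun n => c * (/ INR (n + 1) - / INR (n + 2)))) c).
    apply is_lim_seq_ext with (fun n => c * (1 - / INR (n + 2))).
    - intros n; induction n as [| n IH].
      + rewrite sum_O; simpl; field.
      + rewrite sum_Sn, <- IH; unfold plus; simpl plus.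
        replace (S n + 1)%nat with (n + 2)%nat by lia; simpl; ring.
    - replace (Finite c) with (Rbar_mult c (1 - 0)) by (simpl; f_equal; ring).
      apply is_lim_seq_scal_l, is_lim_seq_minus'; [apply is_lim_seq_const |].
      apply (is_lim_seq_incr_n (fun n => / INR n) 2).
      replace (Finite 0) with (Rbar_inv p_infty) by reflexivity.
      apply is_lim_seq_inv; [apply is_lim_seq_INR | discriminate]. }
  assert (hex : ex_series (fun n => a (S n))).
  { apply (@ex_series_le R_AbsRing R_CompleteNormedModule) with
      (2 := ex_intro _ c hb).
    intros n; unfold norm; simpl; unfold abs; simpl.
    rewrite Rabs_pos_eq; apply ha. }
  rewrite Series_incr_1, ha0 by now apply ex_series_incr_1.
  split; apply Rplus_le_compat_l.
  - rewrite Series_incr_1 by exact hex.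
    assert (h0 : 0 <= Series (fun n => a (S (S n)))).
    { rewrite <- (Rmult_0_l (Series (fun n => a (S (S n))))), <- Series_scal_l.
      apply Series_le.
      - intros n; rewrite Rmult_0_l; split; [lra | apply ha].
      - now apply (ex_series_incr_1 (fun n => a (S n))). }
    lra.
  - rewrite <- (is_series_unique _ _ hb); apply Series_le; [exact ha |].
    now exists c.
Qed.

(** Of ten factors [n + 2], eight supply [2 ^ 8 = 256] and two dominate [(n + 1) * (n + 2)]. *)
Lemma inv_pow_le_telescope (n k : nat) :
  (10 <= k)%nat ->
  / INR (n + 2) ^ k <= / 256 * (/ INR (n + 1) - / INR (n + 2)).
Proof.
  intros hk.
  assert (hn := pos_INR n); rewrite !plus_INR; simpl INR.
  set (y := INR n) in *.
  replace (/ 256 * (/ (y + 1) - / (y + (1 + 1)))) with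
    (/ (256 * ((y + 1) * (y + 2)))) by (field; lra).
  apply Rinv_le_contravar; [nra |].
  apply Rle_trans with ((y + (1 + 1)) ^ 10); [| apply Rle_pow; lra || lia].
  change 10%nat with (8 + 2)%nat; rewrite pow_add.
  assert (h8 : 2 ^ 8 <= (y + (1 + 1)) ^ 8) by (apply pow_incr; lra).
  apply Rmult_le_compat; nra.
Qed.

Lemma zeta_bounds (k : nat) :
  (10 <= k)%nat -> 1 + / 2 ^ k <= zeta k <= 1 + / 256.
Proof.
  intros hk; unfold zeta.
  apply (Series_telescope_bounds (fun n => / INR (n + 1) ^ k)).
  - simpl; rewrite pow1; field.
  - intros n; split.
    + left; apply Rinv_0_lt_compat, pow_lt, lt_0_INR; lia.
    + replace (S n + 1)%nat with (n + 2)%nat by lia.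
      now apply inv_pow_le_telescope.
Qed.

Lemma theta_bounds (k : nat) :
  (10 <= k)%nat -> 1 + / 3 ^ k <= theta k <= 1 + / 256.
Proof.
  intros hk; unfold theta.
  replace 3 with (INR (2 * 1 + 1)) by (simpl; ring).
  apply (Series_telescope_bounds (fun n => / INR (2 * n + 1) ^ k)).
  - simpl; rewrite pow1; field.
  - intros n; split.
    + left; apply Rinv_0_lt_compat, pow_lt, lt_0_INR; lia.
    (* Since [2 * S n + 1 >= n + 2], each term is at most the matching term of zeta. *)
    + apply Rle_trans with (2 := inv_pow_le_telescope n k hk).
      apply Rinv_le_contravar; [apply pow_lt, lt_0_INR; lia |].
      apply pow_incr; split; [apply pos_INR | apply le_INR; lia].
Qed.

(** * The inequalities in terms of d, given a small truncation error *)

(** With [g = sin (PI * d) / PI], the difference from [1 / (1 + d)] is [(d - g) / (1 + d)], which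
    lies in [[0, 2 d^3]], plus an error of at most [d^3]. It thus lies in [[-d^3, 3 d^3]]. *)
Lemma one_plus_q_poly_bounds (s : nat) (d : R) :
  (2 <= s)%nat -> 0 <= d <= / 256 ->
  (101 / 10) ^ s / INR (fact (2 * s + 1)) <= d ^ 3 ->
  1 / (1 + d) - d ^ 3 <= 1 + q_poly s (1 + d) <= 1 / (1 + d) + 11 * d ^ 3.
Proof.
  intros hs hd hE.
  assert (he := q_poly_one_plus_error s d hs hd).
  apply Rabs_le_between in he.
  assert (hg := sin_PI_mul_div_PI_bounds d ltac:(lra)).
  set (g := sin (PI * d) / PI) in *.
  assert (hx : 1 / (1 + d) = 1 - d / (1 + d)) by (field; lra).
  assert (hd3 : 0 <= d ^ 3) by (apply pow_le; lra).
  assert (h1 : g / (1 + d) <= d / (1 + d)).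
  { apply Rmult_le_compat_r; [left; apply Rinv_0_lt_compat |]; lra. }
  assert (h2 : d / (1 + d) - 2 * d ^ 3 <= g / (1 + d)).
  { apply Rmult_le_reg_r with (1 + d); [lra |].
    replace (g / (1 + d) * (1 + d)) with g by (field; lra).
    replace ((d / (1 + d) - 2 * d ^ 3) * (1 + d)) with
      (d - 2 * d ^ 3 * (1 + d)) by (field; lra).
    nra. }
  lra.
Qed.

(** Here [c] stands for the extra leading term of [z_poly] or [t_poly]. The main part [g / (1 + d)]
    of [p_poly - 1] is about [d - d^2]; it lies between [d - 2 d^2] and [d - d^2 / 2], leaving room
    [d^2 / 2] for [c] and the truncation error together. *)
Lemma p_poly_add_bounds (s : nat) (d c : R) :
  (2 <= s)%nat -> 0 <= d <= / 256 ->
  Rabs c + (101 / 10) ^ s / INR (fact (2 * s + 1)) <= d ^ 2 / 2 ->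
  1 + d - 3 * d ^ 2 <= c + p_poly s (1 + d) <= 1 + d.
Proof.
  intros hs hd hE.
  assert (he := q_poly_one_plus_error s d hs hd).
  apply Rabs_le_between in he.
  assert (hc := Rle_refl (Rabs c)); apply Rabs_le_between in hc.
  assert (hg := sin_PI_mul_div_PI_bounds d ltac:(lra)).
  set (g := sin (PI * d) / PI) in *.
  rewrite p_poly_q_poly by lia.
  assert (hd2 : 0 <= d ^ 2) by apply pow2_ge_0.
  assert (h1 : g / (1 + d) <= d - d ^ 2 / 2).
  { apply Rmult_le_reg_r with (1 + d); [lra |].
    replace (g / (1 + d) * (1 + d)) with g by (field; lra).
    nra. }
  assert (h2 : d - 2 * d ^ 2 <= g / (1 + d)).
  { apply Rmult_le_reg_r with (1 + d); [lra |].
    replace (g / (1 + d) * (1 + d)) with g by (field; lra).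
    nra. }
  lra.
Qed.

Lemma PI_pow_double_bounds (s : nat) : 0 <= PI ^ (2 * s) <= (101 / 10) ^ s.
Proof.
  assert (hP := PI_RGT_0). assert (hP' := PI_lt_315).
  split; [apply pow_le; lra |].
  rewrite pow_mult; apply pow_incr; nra.
Qed.

Lemma div_fact_double_succ (s : nat) (y : R) :
  y / INR (fact (2 * s + 1)) = y / INR (fact (2 * s)) / (2 * INR s + 1).
Proof.
  replace (2 * s + 1)%nat with (S (2 * s)) by lia.
  rewrite fact_simpl, mult_INR, S_INR, mult_INR; simpl (INR 2).
  assert (hs := pos_INR s).
  field; split; [apply INR_fact_neq_0 | lra].
Qed.

(** With [M = (101 / 10)^s / (2s)!], the extra term is at most [s M / (2s + 1)] in absolute value
    and the truncation error is [M / (2s + 1)]; together they stay below [M]. *)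
Lemma z_poly_bounds (s : nat) (d : R) :
  (2 <= s)%nat -> 0 <= d <= / 256 ->
  2 * ((101 / 10) ^ s / INR (fact (2 * s))) <= d ^ 2 ->
  1 + d - 3 * d ^ 2 <= z_poly s (1 + d) <= 1 + d.
Proof.
  intros hs hd hM; unfold z_poly.
  apply p_poly_add_bounds; [assumption .. |].
  assert (hF := INR_fact_lt_0 (2 * s)).
  assert (hP := PI_pow_double_bounds s).
  assert (hs' : 2 <= INR s) by (apply (le_INR 2); lia).
  rewrite !div_fact_double_succ.
  set (M := (101 / 10) ^ s / INR (fact (2 * s))) in *.
  assert (hM' : 0 <= PI ^ (2 * s) / INR (fact (2 * s)) <= M).
  { split; [apply Rdiv_le_0_compat; lra |].
    apply Rmult_le_compat_r; [left; now apply Rinv_0_lt_compat | lra]. }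
  replace ((-1) ^ (s - 1) * INR s * PI ^ (2 * s) / INR (fact (2 * s)) /
    (2 * INR s + 1)) with
    ((-1) ^ (s - 1) *
     (INR s * (PI ^ (2 * s) / INR (fact (2 * s))) / (2 * INR s + 1)))
    by (field; lra).
  rewrite Rabs_mult, pow_1_abs, Rmult_1_l, Rabs_pos_eq
    by (apply Rdiv_le_0_compat; nra).
  apply Rmult_le_reg_r with (2 * INR s + 1); [lra |].
  set (N := PI ^ (2 * s) / INR (fact (2 * s))) in *.
  replace ((INR s * N / (2 * INR s + 1) + M / (2 * INR s + 1)) *
    (2 * INR s + 1)) with (INR s * N + M) by (field; lra).
  nra.
Qed.

(** The extra term is at most [M / 4] in absolute value, and so is the truncation error
    [M / (2s + 1)], as [2s + 1 >= 4]. *)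
Lemma t_poly_bounds (s : nat) (d : R) :
  (2 <= s)%nat -> 0 <= d <= / 256 ->
  (101 / 10) ^ s / INR (fact (2 * s)) <= d ^ 2 ->
  1 + d - 3 * d ^ 2 <= t_poly s (1 + d) <= 1 + d.
Proof.
  intros hs hd hM; unfold t_poly.
  apply p_poly_add_bounds; [assumption .. |].
  assert (hF := INR_fact_lt_0 (2 * s)).
  assert (hP := PI_pow_double_bounds s).
  assert (hs' : 2 <= INR s) by (apply (le_INR 2); lia).
  rewrite div_fact_double_succ.
  set (M := (101 / 10) ^ s / INR (fact (2 * s))) in *.
  assert (hM' : 0 <= PI ^ (2 * s) / INR (fact (2 * s)) <= M).
  { split; [apply Rdiv_le_0_compat; lra |].
    apply Rmult_le_compat_r; [left; now apply Rinv_0_lt_compat | lra]. }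
  replace ((-1) ^ (s - 1) * PI ^ (2 * s) / (4 * INR (fact (2 * s)))) with
    ((-1) ^ (s - 1) * (PI ^ (2 * s) / INR (fact (2 * s)) / 4)) by (field; lra).
  rewrite Rabs_mult, pow_1_abs, Rmult_1_l, Rabs_pos_eq by lra.
  assert (hE : M / (2 * INR s + 1) <= M / 4).
  { apply Rmult_le_compat_l; [lra | apply Rinv_le_contravar; lra]. }
  lra.
Qed.

(** * The four thresholds *)

Theorem theorem1p5 (s k : nat) (hs : (1 <= s)%nat)
    (hk : k = (2 * s)%nat \/ k = (2 * s - 1)%nat) :
  ((17 <= s)%nat ->
     zeta k - 3 * frac_part (zeta k) ^ 2 <= z_poly s (zeta k) <= zeta k) /\
  ((38 <= s)%nat ->
     theta k - 3 * frac_part (theta k) ^ 2 <= t_poly s (theta k) <= theta k) /\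
  ((34 <= s)%nat ->
     1 / zeta k - frac_part (zeta k) ^ 3 <= 1 + q_poly s (zeta k)
       <= 1 / zeta k + 11 * frac_part (zeta k) ^ 3) /\
  ((114 <= s)%nat ->
     1 / theta k - frac_part (theta k) ^ 3 <= 1 + q_poly s (theta k)
       <= 1 / theta k + 11 * frac_part (theta k) ^ 3).
Proof.
  assert (hk' : (k <= 2 * s)%nat) by lia.
  assert (hz : (17 <= s)%nat -> exists d : R,
    zeta k = 1 + d /\ frac_part (zeta k) = d /\ / 2 ^ k <= d /\ 0 <= d <= / 256).
  { intros h; exists (zeta k - 1).
    assert (hb := zeta_bounds k ltac:(lia)).
    assert (hp : 0 < / 2 ^ k) by (apply Rinv_0_lt_compat, pow_lt; lra).
    assert (hf := frac_part_one_plus (zeta k - 1) ltac:(lra)).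
    replace (1 + (zeta k - 1)) with (zeta k) in hf by ring.
    repeat split; lra. }
  assert (ht : (17 <= s)%nat -> exists d : R,
    theta k = 1 + d /\ frac_part (theta k) = d /\ / 3 ^ k <= d /\ 0 <= d <= / 256).
  { intros h; exists (theta k - 1).
    assert (hb := theta_bounds k ltac:(lia)).
    assert (hp : 0 < / 3 ^ k) by (apply Rinv_0_lt_compat, pow_lt; lra).
    assert (hf := frac_part_one_plus (theta k - 1) ltac:(lra)).
    replace (1 + (theta k - 1)) with (theta k) in hf by ring.
    repeat split; lra. }
  assert (hM : 0 <= (101 / 10) ^ s / INR (fact (2 * s))).
  { apply Rdiv_le_0_compat; [apply pow_le; lra | apply INR_fact_lt_0]. }
  split; [| split; [| split]]; intros h.
  - destruct (hz ltac:(lia)) as (d & -> & -> & hd & hd').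
    apply z_poly_bounds; [lia | assumption |].
    (* In each case [c] is [101 / 10 * b ^ (2 * j)] rounded up, here [161.6] to [162]. The
       comparison left to evaluate is [2 * 162 ^ 17 <= 34!]. *)
    assert (hf := pow_div_fact_le 2 1 162 2 2 k 17 s d).
    specialize (hf h ltac:(lia) ltac:(lia) ltac:(lia) hk' hd).
    specialize (hf ltac:(lia) ltac:(lia)); lapply hf; [lra | now vm_compute].
  - destruct (ht ltac:(lia)) as (d & -> & -> & hd & hd').
    apply t_poly_bounds; [lia | assumption |].
    assert (hf := pow_div_fact_le 1 1 819 3 2 k 38 s d).
    specialize (hf h ltac:(lia) ltac:(lia) ltac:(lia) hk' hd).
    specialize (hf ltac:(lia) ltac:(lia)); lapply hf; [lra | now vm_compute].
  - destruct (hz ltac:(lia)) as (d & -> & -> & hd & hd').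
    apply one_plus_q_poly_bounds; [lia | assumption |].
    assert (hf := pow_div_fact_le 1 1 647 2 3 k 34 s d).
    specialize (hf h ltac:(lia) ltac:(lia) ltac:(lia) hk' hd).
    specialize (hf ltac:(lia) ltac:(lia)).
    assert (hs' : 34 <= INR s) by (rewrite INR_IZR_INZ; apply IZR_le; lia).
    rewrite div_fact_double_succ; apply Rle_div_l; [lra |].
    lapply hf; [nra | now vm_compute].
  - destruct (ht ltac:(lia)) as (d & -> & -> & hd & hd').
    apply one_plus_q_poly_bounds; [lia | assumption |].
    (* The slack 200 is absorbed by the further denominator [2 * s + 1 >= 229] of the truncation
       error. *)
    assert (hf := pow_div_fact_le 1 200 7363 3 3 k 114 s d).
    specialize (hf h ltac:(lia) ltac:(lia) ltac:(lia) hk' hd).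
    specialize (hf ltac:(lia) ltac:(lia)).
    assert (hs' : 114 <= INR s) by (rewrite INR_IZR_INZ; apply IZR_le; lia).
    rewrite div_fact_double_succ; apply Rle_div_l; [lra |].
    lapply hf; [nra | now vm_compute].
Qed.
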